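(* Let $ABC$ be a (nondegenerate) triangle in the Euclidean plane. Suppose there exist a cevian $AA_1$ issuing from $A$ (with $A_1$ on the line $(BC)$) and a cevian $BB_1$ issuing from $B$ (with $B_1$ on the line $(AC)$) such that $|AA_1| = |BB_1|$ and such that the cevians $AA_1$ and $BB_1$ intersect at a point lying on the bisector of the angle $C$ of the triangle. Then $ABC$ is isosceles with $AC = BC$.
   Context: A cevian of a triangle is a segment joining a vertex of the triangle to a point that lies on the opposite side or on its extension and is different from the endpoints of that side. $(XY)$ denotes the line through points $X$ and $Y$. The bisector of angle $C$ is the ray from $C$ bisecting the angle $\angle ACB$. *)

(* Defs.v *)
From mathcomp Require Import all_boot all_order all_algebra.
From mathcomp Require Import boolp classical_sets reals trigo.

Set Implicit Arguments.
Unset Strict Implicit.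
Unset Printing Implicit Defensive.

Import Order.TTheory GRing.Theory Num.Theory.

Local Open Scope classical_set_scope.
Local Open Scope ring_scope.

(* The Euclidean plane is 'rV[R]_2 with the dot product below; the norm that
   MathComp-Analysis puts on 'rV[R]_2 is the sup norm, so it is not used. *)
Definition dot (R : realType) (u v : 'rV[R]_2) : R :=
  \sum_(i < 2) u 0 i * v 0 i.

Definition enorm (R : realType) (u : 'rV[R]_2) : R := Num.sqrt (dot u u).

Definition edist (R : realType) (X Y : 'rV[R]_2) : R := enorm (Y - X).

(* Only meaningful as the line (XY) when X != Y. *)
Definition line (R : realType) (X Y : 'rV[R]_2) : set 'rV[R]_2 :=
  [set Z | exists t : R, Z = X + t *: (Y - X)].

Definition segment (R : realType) (X Y : 'rV[R]_2) : set 'rV[R]_2 :=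
  [set Z | exists2 t : R, 0 <= t <= 1 & Z = X + t *: (Y - X)].

Definition collinear (R : realType) (X Y Z : 'rV[R]_2) : Prop :=
  exists P Q : 'rV[R]_2,
    [/\ P != Q, line P Q X, line P Q Y & line P Q Z].

Definition triangle (R : realType) (A B C : 'rV[R]_2) : Prop :=
  ~ collinear A B C.

(* The unoriented angle XVY, in [0, pi]; only meaningful when X and Y both
   differ from V. *)
Definition angle (R : realType) (X V Y : 'rV[R]_2) : R :=
  acos (dot (X - V) (Y - V) / (enorm (X - V) * enorm (Y - V))).

(* The ray from V halving the angle XVY. Requiring each part to be half of the
   angle, and not merely the two parts to be equal, excludes the opposite ray.
   The origin V is added separately since angles with a side reduced to a
   point are meaningless. *)
Definition angle_bisector (R : realType) (X V Y : 'rV[R]_2) :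
    set 'rV[R]_2 :=
  [set P | P = V \/
           angle X V P = angle X V Y / 2 /\ angle P V Y = angle X V Y / 2].

(* [segment V W] is a cevian issuing from V of the triangle V, X, Y. *)
Definition is_cevian (R : realType) (V X Y W : 'rV[R]_2) : Prop :=
  [/\ line X Y W, W != X & W != Y].

(* Main.v *)
Require Import Defs.
From mathcomp Require Import all_boot all_order all_algebra.
From mathcomp Require Import boolp classical_sets reals trigo.
From mathcomp Require Import ring lra.

Set Implicit Arguments.
Unset Strict Implicit.
Unset Printing Implicit Defensive.

(** Put the origin at [C] and let [a = |CA|], [b = |CB|] and [c = cos C], so
    that [-1 < c < 1].  In the basis of unit vectors along [CA] and [CB], the
    common point of the cevians has two equal coordinates [p], because it lies
    on the bisector ([bisector_coords]); moreover [p > 0], since otherwise the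
    common point is [C] and [A1 = C].  If [A1] is at abscissa [y] on the line
    [CB] and [B1] at abscissa [x] on the line [CA], both oriented from [C], then
    [x] and [y] are positive because the common point lies on the segments
    [AA1] and [BB1], and the incidences say [1/a + 1/y = 1/p = 1/b + 1/x].
    By the law of cosines,
    [|AA1|^2 = (a + y)^2 - 2(1 + c)ay = m^2/p^2 - 2(1 + c)m] with [m = ay],
    and similarly for [|BB1|^2] with [n = bx].  Equality of the two cevians
    forces [m = n] or [m + n = 2(1 + c)p^2]; the latter is impossible since
    [m] and [n] are at least [4p^2] by the inequality of the means.  Hence
    [{a, y}] and [{b, x}] have the same sum and the same product
    ([equal_cevians_scalar]), so that [a = b], or else [y = b]; the latter
    means [A1 = B], which the definition of a cevian excludes. *)

Import Order.TTheory GRing.Theory Num.Theory.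

Local Open Scope classical_set_scope.
Local Open Scope ring_scope.

(** The cross product [u x v] of two plane vectors, that is, the determinant
    of [(u, v)]. *)
Definition cross (R : realType) (u v : 'rV[R]_2) : R :=
  u 0 0 * v 0 1 - u 0 1 * v 0 0.

Lemma dotE (R : realType) (u v : 'rV[R]_2) :
  dot u v = u 0 0 * v 0 0 + u 0 1 * v 0 1.
Proof.
rewrite /dot big_ord_recl big_ord1.
by congr (_ + u 0 _ * v 0 _); apply/val_inj.
Qed.

Lemma row2P (R : realType) (u v : 'rV[R]_2) :
  u 0 0 = v 0 0 -> u 0 1 = v 0 1 -> u = v.
Proof.
move=> e0 e1; apply/rowP => -[[|[|//]] i].
- by rewrite (_ : Ordinal i = 0) //; apply/val_inj.
- by rewrite (_ : Ordinal i = 1) //; apply/val_inj.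
Qed.

Lemma dot_lincomb (R : realType) (u v : 'rV[R]_2) (x y z w : R) :
  dot (x *: u + y *: v) (z *: u + w *: v) =
  x * z * dot u u + (x * w + y * z) * dot u v + y * w * dot v v.
Proof. by rewrite !dotE !mxE; ring. Qed.

Lemma lagrange_identity (R : realType) (u v : 'rV[R]_2) :
  dot u v ^+ 2 + cross u v ^+ 2 = dot u u * dot v v.
Proof. by rewrite !dotE /cross; ring. Qed.

Lemma dot_ge0 (R : realType) (u : 'rV[R]_2) : 0 <= dot u u.
Proof. by rewrite dotE -!expr2 addr_ge0 ?sqr_ge0. Qed.

Lemma enorm_ge0 (R : realType) (u : 'rV[R]_2) : 0 <= enorm u.
Proof. exact: sqrtr_ge0. Qed.

Lemma sqr_enorm (R : realType) (u : 'rV[R]_2) : enorm u ^+ 2 = dot u u.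
Proof. by rewrite sqr_sqrtr ?dot_ge0. Qed.

Lemma enormN (R : realType) (u : 'rV[R]_2) : enorm (- u) = enorm u.
Proof. by congr Num.sqrt; rewrite !dotE !mxE; ring. Qed.

Lemma enorm_gt0 (R : realType) (u : 'rV[R]_2) : u != 0 -> 0 < enorm u.
Proof.
move=> u0; rewrite lt_neqAle enorm_ge0 andbT eq_sym.
apply: contra u0 => /eqP n0; have := sqr_enorm u.
rewrite n0 expr0n /= dotE => /esym/eqP.
rewrite -!expr2 paddr_eq0 ?sqr_ge0 // !sqrf_eq0 => /andP[/eqP e0 /eqP e1].
by apply/eqP; apply: row2P; rewrite mxE.
Qed.

Lemma cauchy_schwarz (R : realType) (u v : 'rV[R]_2) :
  `|dot u v| <= enorm u * enorm v.
Proof.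
rewrite -(@ler_pXn2r _ 2) ?nnegrE ?mulr_ge0 ?enorm_ge0 //.
by rewrite real_normK ?num_real // exprMn !sqr_enorm -lagrange_identity
  lerDl sqr_ge0.
Qed.

Lemma cauchy_schwarz_strict (R : realType) (u v : 'rV[R]_2) :
  cross u v != 0 -> `|dot u v| < enorm u * enorm v.
Proof.
move=> uv; rewrite -(@ltr_pXn2r _ 2) ?nnegrE ?mulr_ge0 ?enorm_ge0 //.
rewrite real_normK ?num_real // exprMn !sqr_enorm -lagrange_identity ltrDl.
by rewrite exprn_even_gt0.
Qed.

Lemma cross_lincomb_inj (R : realType) (u v : 'rV[R]_2) (x y z w : R) :
  cross u v != 0 -> x *: u + y *: v = z *: u + w *: v -> x = z /\ y = w.
Proof.
move=> uv /rowP E; have := E 1; have := E 0; rewrite !mxE => E0 E1.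
(* Cramer's rule *)
split; apply: (mulfI uv); rewrite /cross.
- have := congr1 ( *%R (v 0 1)) E0; have := congr1 ( *%R (v 0 0)) E1; lra.
- have := congr1 ( *%R (u 0 1)) E0; have := congr1 ( *%R (u 0 0)) E1; lra.
Qed.

Lemma cross_neq0 (R : realType) (u v : 'rV[R]_2) :
  cross u v != 0 -> u != 0 /\ v != 0.
Proof.
by move=> uv; split; apply: contra uv => /eqP->; rewrite /cross !mxE;
  apply/eqP; ring.
Qed.

Lemma triangle_cross (R : realType) (A B C : 'rV[R]_2) :
  triangle A B C -> cross (A - C) (B - C) != 0.
Proof.
move=> tri; apply/eqP => cr0; apply: tri.
have lineC X : X != C -> line C X C /\ line C X X.
  by move=> _; split; [exists 0|exists 1];
    rewrite ?scale0r ?addr0 // scale1r addrC subrK.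
have [eAC|AC] := eqVneq A C.
  have [eBC|BC] := eqVneq B C.
    (* All three points coincide: any line through [C] will do. *)
    exists C, (C + const_mx 1); rewrite eAC eBC.
    have CC : line C (C + const_mx 1) C by exists 0; rewrite scale0r addr0.
    split=> //; apply/eqP => /rowP/(_ 0); rewrite !mxE; lra.
  by exists C, B; have [? ?] := lineC B BC; rewrite eAC; split; rewrite // eq_sym.
exists C, A; have [? ?] := lineC A AC; split; rewrite // 1?eq_sym //.
(* [B] is its own orthogonal projection on the line [(CA)]. *)
exists (dot (A - C) (B - C) / dot (A - C) (A - C)).
have : 0 < enorm (A - C) by rewrite enorm_gt0 ?subr_eq0.
have := sqr_enorm (A - C); set n := enorm _ => n2 n0.
have d0 : dot (A - C) (A - C) != 0 by rewrite -n2 expf_neq0 ?gt_eqF.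
apply/(@addIr _ (- C)); rewrite addrAC subrr add0r.
apply/(scalerI d0); rewrite scalerA mulrCA divff // mulr1.
move: cr0; rewrite /cross; set u := A - C; set v := B - C => cr0.
rewrite !dotE; apply: row2P; rewrite [LHS]mxE [RHS]mxE.
- have := congr1 ( *%R (u 0 1)) cr0; lra.
- have := congr1 ( *%R (u 0 0)) cr0; lra.
Qed.

Lemma cos_angle (R : realType) (X V Y : 'rV[R]_2) :
  cos (angle X V Y) =
  dot (X - V) (Y - V) / (enorm (X - V) * enorm (Y - V)).
Proof.
rewrite /angle; set n := _ * enorm _.
have n0 : 0 <= n by rewrite mulr_ge0 ?enorm_ge0.
suff h : -1 <= dot (X - V) (Y - V) / n <= 1 by apply: acosK.
rewrite -ler_norml normrM normfV (ger0_norm n0).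
move: n0; rewrite le0r => /orP[/eqP->|n0]; first by rewrite invr0 mulr0.
by rewrite ler_pdivrMr // mul1r cauchy_schwarz.
Qed.

Lemma cos_half_angle_ge0 (R : realType) (X V Y : 'rV[R]_2) :
  0 <= cos (angle X V Y / 2).
Proof.
have [t0 tpi] : 0 <= angle X V Y /\ angle X V Y <= pi.
  have : -1 <= dot (X - V) (Y - V) / (enorm (X - V) * enorm (Y - V)) <= 1.
    by rewrite -cos_angle cos_geN1 cos_le1.
  by move=> h; split; [exact: acos_ge0|exact: acos_lepi].
have pi0 := pi_ge0 R.
apply: cos_ge0_pihalf; apply/andP; split; lra.
Qed.

(** In the basis of unit vectors along the sides, the two coordinates
    [x * enorm (A - C)] and [y * enorm (B - C)] of a point of the bisector
    are equal and nonnegative. *)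
Lemma bisector_coords (R : realType) (A B C : 'rV[R]_2) (x y : R) :
  cross (A - C) (B - C) != 0 ->
  angle_bisector A C B (C + (x *: (A - C) + y *: (B - C))) ->
  x * enorm (A - C) = y * enorm (B - C) /\ 0 <= x * enorm (A - C).
Proof.
set u := A - C; set v := B - C; set q := _ + y *: v => uv.
have [u0 v0] := cross_neq0 uv.
have a0 := enorm_gt0 u0; have b0 := enorm_gt0 v0.
have := cauchy_schwarz_strict uv; rewrite ltr_norml => /andP[dgt dlt].
have qC : C + q - C = q by rewrite addrAC subrr add0r.
have a2 := sqr_enorm u; have b2 := sqr_enorm v.
have uq : dot u q = x * enorm u ^+ 2 + y * dot u v.
  by rewrite a2 !dotE /q !mxE; ring.
have qv : dot q v = x * dot u v + y * enorm v ^+ 2.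
  by rewrite b2 !dotE /q !mxE; ring.
have [q0|qn0] := eqVneq q 0.
  have [|-> ->] := @cross_lincomb_inj _ u v x y 0 0 uv.
    by rewrite -/q q0 !scale0r addr0.
  by rewrite !mul0r.
have n0 := enorm_gt0 qn0.
case=> [/(congr1 (fun z => z - C))|[e1 e2]].
  by rewrite qC subrr => q0; rewrite q0 eqxx in qn0.
have h0 := cos_half_angle_ge0 A C B.
have c1 : dot u q = cos (angle A C B / 2) * (enorm u * enorm q).
  by rewrite -e1 cos_angle qC -/u divfK // mulf_neq0 // gt_eqF.
have c2 : dot q v = cos (angle A C B / 2) * (enorm q * enorm v).
  by rewrite -e2 cos_angle qC -/v divfK // mulf_neq0 // gt_eqF.
have exy : x * enorm u = y * enorm v.
  (* The equality of the two cosines amounts to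
     [(|u||v| - u.v) (x|u| - y|v|) = 0], whose first factor is nonzero
     by strict Cauchy-Schwarz. *)
  have dn0 : enorm u * enorm v - dot u v != 0 by rewrite gt_eqF // subr_gt0.
  apply: (mulfI dn0); rewrite uq in c1; rewrite qv in c2.
  have := congr1 ( *%R (enorm v)) c1; have := congr1 ( *%R (enorm u)) c2; lra.
split=> //.
have s0 : 0 < enorm u * enorm v + dot u v by lra.
rewrite -(pmulr_lge0 _ s0).
have -> : x * enorm u * (enorm u * enorm v + dot u v) = enorm v * dot u q.
  by rewrite uq; have := congr1 ( *%R (dot u v)) exy; lra.
by rewrite c1 !mulr_ge0 // ltW.
Qed.

(** The algebraic core: [1/a + 1/y = 1/p = 1/b + 1/x] and the law of cosines
    leave only the two ways of matching [{a, y}] with [{b, x}]. *)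
Lemma equal_cevians_scalar (R : realFieldType) (a b x y p c : R) :
  0 < a -> 0 < b -> 0 < x -> 0 < y -> 0 < p -> c < 1 ->
  p * (a + y) = a * y -> p * (b + x) = b * x ->
  a ^+ 2 + y ^+ 2 - 2 * c * (a * y) = b ^+ 2 + x ^+ 2 - 2 * c * (b * x) ->
  a = b \/ y = b.
Proof.
move=> a0 b0 x0 y0 p0 c1 ey ex E.
have mean u v : 0 < u -> 0 < v -> p * (u + v) = u * v ->
    4 * p ^+ 2 <= u * v.
  move=> u0 v0 e; rewrite -(ler_pM2r (mulr_gt0 u0 v0)).
  (* [4uv <= (u + v)^2] and [u + v = uv/p] *)
  have -> : u * v * (u * v) = p ^+ 2 * (u + v) ^+ 2 by rewrite -e; ring.
  rewrite -mulrA mulrCA ler_pM2l ?exprn_gt0 //.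
  by rewrite -subr_ge0; have := sqr_ge0 (u - v); lra.
have my := mean _ _ a0 y0 ey; have mx := mean _ _ b0 x0 ex.
have F : (a * y - b * x) * (a * y + b * x - 2 * (1 + c) * p ^+ 2) = 0.
  have eqy : (p * (a + y)) ^+ 2 = (a * y) ^+ 2 by rewrite ey.
  have eqx : (p * (b + x)) ^+ 2 = (b * x) ^+ 2 by rewrite ex.
  by have := congr1 ( *%R (p ^+ 2)) E; lra.
have pos : a * y + b * x - 2 * (1 + c) * p ^+ 2 != 0.
  have p2 : 0 < p ^+ 2 by rewrite exprn_gt0.
  have : 0 < (1 - c) * p ^+ 2 by rewrite mulr_gt0 // subr_gt0.
  by move=> ?; rewrite gt_eqF //; lra.
move/eqP: F; rewrite mulf_eq0 (negbTE pos) orbF subr_eq0 => /eqP mn.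
have sum : a + y = b + x by apply: (mulfI (lt0r_neq0 p0)); rewrite ey ex.
have /eqP : (a - b) * (y - b) = 0 by have := congr1 ( *%R b) sum; lra.
by rewrite mulf_eq0 !subr_eq0 => /orP[] /eqP; [left|right].
Qed.

Theorem mainTheorem1 (R : realType) (A B C : 'rV[R]_2)
    (hABC : triangle A B C)
    (hcev : exists A1 B1 : 'rV[R]_2,
      [/\ is_cevian A B C A1,
          is_cevian B A C B1,
          edist A A1 = edist B B1
        & exists P : 'rV[R]_2,
            [/\ segment A A1 P, segment B B1 P & angle_bisector A C B P]]) :
  edist A C = edist B C.
Proof.
have := triangle_cross hABC.
case: hcev => A1 [B1 [[[y' eA1] A1B A1C] [[x' eB1] _ _] eqd [P []]]].
move=> [t /andP[t0 t1] eP] [s /andP[s0 s1] eP'] bis uv.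
rewrite /edist -enormN opprB -(enormN (C - B)) opprB.
have [u0 v0] := cross_neq0 uv.
have a0 := enorm_gt0 u0; have b0 := enorm_gt0 v0.
have := cauchy_schwarz_strict uv; rewrite ltr_norml => /andP[_ dlt].
pose y := 1 - y'; pose x := 1 - x'.
have P1 : P = C + ((1 - t) *: (A - C) + (t * y) *: (B - C)).
  by rewrite eP eA1 /y; apply: row2P; rewrite !mxE; ring.
have P2 : P = C + ((s * x) *: (A - C) + (1 - s) *: (B - C)).
  by rewrite eP' eB1 /x; apply: row2P; rewrite !mxE; ring.
have [ex ey] : 1 - t = s * x /\ t * y = 1 - s.
  by apply: (cross_lincomb_inj uv); apply: (addrI C);
    rewrite -P1 -P2.
rewrite P1 in bis; have [exy p0] := bisector_coords uv bis.
set a := enorm (A - C) in a0 dlt exy p0 *.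
set b := enorm (B - C) in b0 dlt exy *.
have p_gt0 : 0 < (1 - t) * a.
  rewrite lt_neqAle p0 andbT eq_sym; apply/eqP => pe0.
  (* The common point is then [C], and [A1 = C]. *)
  have /eqP : (1 - t) * a = 0 by [].
  rewrite mulf_eq0 (gt_eqF a0) orbF subr_eq0 => /eqP t1'.
  move/esym/eqP: exy; rewrite pe0 -t1' mul1r mulf_eq0 (gt_eqF b0) orbF.
  rewrite /y subr_eq0 => /eqP y1; case/eqP: A1C.
  by rewrite eA1 -y1 scale1r addrC subrK.
have ty0 : 0 < t * y by rewrite -(pmulr_lgt0 _ b0) -exy.
have sx0 : 0 < s * x by rewrite -ex -(pmulr_lgt0 _ a0).
have pos (k z : R) : 0 <= k -> 0 < k * z -> 0 < z.
  by rewrite le0r => /orP[/eqP->|k0]; rewrite ?mul0r ?ltxx // pmulr_rgt0.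
have y0 := pos _ _ t0 ty0; have x0 := pos _ _ s0 sx0.
have c1 : dot (A - C) (B - C) / (a * b) < 1.
  by rewrite ltr_pdivrMr ?mulr_gt0 // mul1r.
(* The law of cosines comes from expanding these in the basis at [C]. *)
have A1E : A1 - A = -1 *: (A - C) + y *: (B - C).
  by rewrite eA1 /y; apply: row2P; rewrite !mxE; ring.
have B1E : B1 - B = x *: (A - C) + -1 *: (B - C).
  by rewrite eB1 /x; apply: row2P; rewrite !mxE; ring.
have := congr1 (fun z => z ^+ 2) eqd; rewrite /= !sqr_enorm A1E B1E.
rewrite !dot_lincomb -!sqr_enorm -/a -/b => E.
have [|||//|yb] := @equal_cevians_scalar _ a b (x * a) (y * b) ((1 - t) * a)
  _ a0 b0 (mulr_gt0 x0 a0) (mulr_gt0 y0 b0) p_gt0 c1.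
- by have := congr1 ( *%R a) exy; lra.
- rewrite ey in exy; have := congr1 ( *%R (a * b)) ex.
  by have := congr1 ( *%R (x * a)) exy; lra.
- have -> : a * (y * b) = y * (a * b) by ring.
  have -> : b * (x * a) = x * (a * b) by ring.
  have dE z : 2 * (dot (A - C) (B - C) / (a * b)) * (z * (a * b)) =
      2 * z * dot (A - C) (B - C) by field; rewrite !gt_eqF.
  by rewrite !dE; lra.
- case/eqP: A1B; have /eqP : y * b = 1 * b by rewrite mul1r.
  rewrite (inj_eq (mulIf (lt0r_neq0 b0))) /y => /eqP y1.
  have y'0 : y' = 0 by lra.
  by rewrite eA1 y'0 scale0r addr0.
Qed.
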